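(* Let $\Lambda$ be an infinite set (countable or uncountable) and let $\Gamma$ be a subshift of $\Lambda^\omega$. If $\Gamma$ is a subshift of finite type, then $\Gamma$ is internally chain transitive (for $\sigma$).
   Context: Let $\omega=\{0,1,2,\dots\}$. $\Lambda^\omega$ is the set of infinite sequences $x=x_0x_1x_2\cdots$ over $\Lambda$, with the product topology where $\Lambda$ is discrete, metrized by $d(x,y)=\inf\{2^{-n}: x_i=y_i \text{ for all } i<n\}$; the shift map is $\sigma(x_0x_1x_2\cdots)=x_1x_2\cdots$. A subshift of $\Lambda^\omega$ is a closed set $\Gamma\subseteq\Lambda^\omega$ with $\sigma(\Gamma)=\Gamma$. A word is a finite sequence over $\Lambda$ of length at least $1$; it is allowed for $\Gamma$ if it occurs as a block of consecutive symbols (subword) of some $x\in\Gamma$, and forbidden otherwise. A basis for the forbidden words of $\Gamma$ is a set $\mathcal F$ of forbidden words such that every forbidden word contains some element of $\mathcal F$ as a subword. $\Gamma$ is a subshift of finite type (SFT) if it has a finite basis for its forbidden words. For $\delta>0$, a $\delta$-chain from $a$ to $b$ is a finite sequence $x_0,x_1,\dots,x_n$ with $n\ge1$, $x_0=a$, $x_n=b$ and $d(\sigma(x_i),x_{i+1})<\delta$ for all $i<n$. A set $A$ is internally chain transitive (ICT) if for all $a,b\in A$ and all $\delta>0$ there is a $\delta$-chain from $a$ to $b$ consisting of elements of $A$. *)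

(* Defs.v *)
From mathcomp Require Import all_boot all_order all_algebra.
From mathcomp Require Import all_classical all_reals all_analysis.

Set Implicit Arguments.
Unset Strict Implicit.
Unset Printing Implicit Defensive.

Import Order.TTheory GRing.Theory Num.Theory.

Local Open Scope classical_set_scope.
Local Open Scope ring_scope.

(* The alphabet is a choiceType only because the library requires one to put
   the discrete topology on it; classically this is no restriction, since any
   T : Type can be taken as {classic T}. *)
Notation omega_seq L := {ptws nat -> discrete_topology L}.

Definition shift (L : choiceType) (x : omega_seq L) : omega_seq L :=
  fun i => x i.+1.

Definition dist (R : realType) (L : choiceType) (x y : omega_seq L) : R :=
  inf [set r : R | exists n : nat,
    (forall i, (i < n)%N -> x i = y i) /\ r = 2 ^- n].

Definition subshift (L : choiceType) (G : set (omega_seq L)) : Prop :=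
  closed G /\ @shift L @` G = G.

Definition occurs (L : choiceType) (w : seq L) (x : omega_seq L) : Prop :=
  exists i : nat, w = mkseq (fun j => x (i + j)%N) (size w).

Definition word (L : choiceType) : set (seq L) := [set w | (0 < size w)%N].

Definition allowed (L : choiceType) (G : set (omega_seq L)) : set (seq L) :=
  [set w | word w /\ exists2 x, G x & occurs w x].

Definition forbidden (L : choiceType) (G : set (omega_seq L)) : set (seq L) :=
  [set w | word w /\ ~ allowed G w].

Definition forbidden_basis (L : choiceType) (G : set (omega_seq L))
    (F : set (seq L)) : Prop :=
  F `<=` forbidden G /\
  forall w, forbidden G w -> exists2 u, F u & infix u w.

Definition finite_type (L : choiceType) (G : set (omega_seq L)) : Prop :=
  exists2 F : set (seq L), finite_set F & forbidden_basis G F.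

(* The finite sequence is x 0, ..., x n; later values of x are irrelevant. *)
Definition delta_chain (R : realType) (L : choiceType) (delta : R)
    (a b : omega_seq L) (n : nat) (x : nat -> omega_seq L) : Prop :=
  [/\ (1 <= n)%N, x 0%N = a, x n = b &
      forall i, (i < n)%N -> dist R (shift (x i)) (x i.+1) < delta].

Definition internally_chain_transitive (R : realType) (L : choiceType)
    (A : set (omega_seq L)) : Prop :=
  forall (a b : omega_seq L) (delta : R), A a -> A b -> 0 < delta ->
  exists (n : nat) (x : nat -> omega_seq L),
    delta_chain delta a b n x /\ (forall i, (i <= n)%N -> A (x i)).

(* Main.v *)
Require Import Defs.
From mathcomp Require Import all_boot all_order all_algebra.
From mathcomp Require Import all_classical all_reals all_analysis.
From mathcomp Require Import zify.

(* A finite basis of forbidden words mentions only finitely many letters, so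
   some letter c occurs in no basis word. If a and b are points of the subshift,
   a word of a_0 ... a_(m-1) c b_0 b_1 ... that contains c cannot be a basis
   word, and the other ones occur in a or in b; hence this sequence belongs to
   the subshift. For large m, replacing its initial point by a turns the first
   m + 1 steps of its orbit into a delta-chain from a to b. *)

Set Implicit Arguments.
Unset Strict Implicit.
Unset Printing Implicit Defensive.

Local Open Scope classical_set_scope.

Import Order.TTheory GRing.Theory Num.Theory.

Lemma iter_shiftE (L : choiceType) (x : omega_seq L) k i :
  iter k (@Defs.shift L) x i = x (k + i)%N.
Proof. by elim: k i => [//|k IHk] i; rewrite iterS /Defs.shift IHk addnS. Qed.

Lemma subshift_iter (L : choiceType) (G : set (omega_seq L)) x k :
  subshift G -> G x -> G (iter k (@Defs.shift L) x).
Proof.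
move=> [_ GE] Gx; elim: k => [//|k IHk].
by rewrite iterS -GE; exists (iter k (@Defs.shift L) x).
Qed.

Lemma dist_le (R : realType) (L : choiceType) (x y : omega_seq L) n :
  (forall i, (i < n)%N -> x i = y i) -> (dist R x y <= 2 ^- n)%R.
Proof.
move=> xy; apply: ge_inf; last by exists n.
by exists 0%R => _ [k [_ ->]]; rewrite invr_ge0 exprn_ge0.
Qed.

Lemma closed_prefix (L : choiceType) (G : set (omega_seq L)) x : closed G ->
  (forall n, exists2 y, G y & forall i, (i < n)%N -> y i = x i) -> G x.
Proof.
move=> Gclosed approx.
have {approx} /choice[y yx] n :
    exists y, G y /\ forall i, (i < n)%N -> y i = x i.
  by have [y] := approx n; exists y.
apply: (@closed_cvg nat (omega_seq L) \oo _ y G Gclosed) => //.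
  by apply: nearW => n; have [] := yx n.
apply/(@pointwise_cvgP nat (discrete_topology L)) => i.
apply: cvg_near_cst; exists i.+1 => // n /= ltin; have [_] := yx n; exact.
Qed.

Lemma nth_occurs (L : choiceType) (w : seq L) (x : omega_seq L) i :
  (forall x0 j, (j < size w)%N -> nth x0 w j = x (i + j)%N) -> occurs w x.
Proof.
move=> wE; exists i; apply: (@eq_from_nth _ (x 0%N)); rewrite ?size_mkseq//.
by move=> j ltj; rewrite nth_mkseq// wE.
Qed.

Lemma occurs_nth (L : choiceType) (w : seq L) (x : omega_seq L) :
  occurs w x ->
  exists i, forall x0 j, (j < size w)%N -> nth x0 w j = x (i + j)%N.
Proof. by move=> [i wE]; exists i => x0 j ltj; rewrite wE nth_mkseq. Qed.

Lemma occurs_infix (L : choiceType) (u w : seq L) (x : omega_seq L) :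
  infix u w -> occurs w x -> occurs u x.
Proof.
move=> /infixP[s1 [s2 ->]] /occurs_nth[i wE].
apply: (@nth_occurs _ _ _ (i + size s1)) => x0 j ltj.
rewrite -addnA -(wE x0) ?size_cat; last by rewrite ltn_add2l ltn_addr.
by rewrite nth_cat ltnNge leq_addr/= addKn nth_cat ltj.
Qed.

Lemma subshift_allowed (L : choiceType) (G : set (omega_seq L)) x :
  subshift G ->
  (forall w, word w -> occurs w x -> allowed G w) -> G x.
Proof.
move=> Gsub allw; apply: closed_prefix; first by case: Gsub.
move=> n.
have /allw[|_ [y Gy /occurs_nth[k kE]]] : word (mkseq x n.+1) by [].
  by exists 0%N; rewrite size_mkseq.
exists (iter k (@Defs.shift L) y) => [|i ltin]; first exact: subshift_iter.
rewrite iter_shiftE -(kE (x 0%N)) ?size_mkseq ?nth_mkseq//; lia.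
Qed.

Definition splice (L : choiceType) (a : omega_seq L) m (c : L) (b : omega_seq L)
    : omega_seq L :=
  fun i => if (i < m)%N then a i else if i == m then c else b (i - m.+1)%N.

Lemma occurs_splice (L : choiceType) (a b : omega_seq L) m c u :
  occurs u (splice a m c b) -> [\/ c \in u, occurs u a | occurs u b].
Proof.
move=> /occurs_nth[i uE].
have [lim|ltmi] := leqP i m; last first.
  constructor 3; apply: (@nth_occurs _ _ _ (i - m.+1)%N) => x0 j ltj.
  rewrite uE// /splice !ifF; [|lia..].
  by congr b; lia.
have [ltm|lem] := ltnP m (i + size u).
  constructor 1.
  have -> : c = nth c u (m - i).
    by rewrite uE ?subnKC /splice ?ltnn ?eqxx//; lia.
  by rewrite mem_nth// ltn_subLR.
constructor 2; apply: (@nth_occurs _ _ _ i) => x0 j ltj.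
by rewrite uE// /splice ifT//; lia.
Qed.

Lemma finite_set_fresh (T : choiceType) (F : set (seq T)) :
  infinite_set [set: T] -> finite_set F ->
  exists c, forall u, F u -> c \notin u.
Proof.
move=> Tinf Ffin.
have := @bigcup_finite _ _ F (fun u => [set` u]) Ffin (fun u _ => finite_seq u).
move=> /(infinite_setD Tinf)/infinite_setN0[c [_ cF]].
by exists c => u Fu; apply/negP => cu; apply: cF; exists u.
Qed.

Lemma subshift_splice (L : choiceType) (G : set (omega_seq L)) F c :
  subshift G -> forbidden_basis G F -> (forall u, F u -> c \notin u) ->
  forall a b m, G a -> G b -> G (splice a m c b).
Proof.
move=> Gsub [Fforb Fbasis] cF a b m Ga Gb.
apply: subshift_allowed => // w w0 wz; apply: contrapT => Nw.
have [//|u Fu uw] := Fbasis w.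
have [u0] := Fforb u Fu; apply; split=> //.
case: (occurs_splice (occurs_infix uw wz)) => [cu|ua|ub].
- by move: (cF u Fu); rewrite cu.
- by exists a.
- by exists b.
Qed.

Theorem lemma18 (R : realType) (L : choiceType) (G : set (omega_seq L))
  (L_infinite : infinite_set [set: L])
  (G_subshift : subshift G)
  (G_finite_type : finite_type G) :
  internally_chain_transitive R G.
Proof.
have [F Ffin Fbasis] := G_finite_type.
have [c cF] := finite_set_fresh L_infinite Ffin.
move=> a b delta Ga Gb delta0.
have [N _ /(_ N (leqnn N))/= Ndelta] :=
  near_infty_natSinv_expn_lt (PosNum delta0).
have Ndist x y :
    (forall i, (i < N)%N -> x i = y i) -> (@dist R L x y < delta)%R.
  move=> /(@dist_le R)/le_lt_trans; apply.
  by move: Ndelta; rewrite div1r.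
pose z := splice a N.+1 c b.
have Gz : G z by exact: subshift_splice Fbasis cF _ _ _ Ga Gb.
exists N.+2, (fun k => if k is 0 then a else iter k (@Defs.shift L) z).
split; last by case=> [|k] _ //; exact: subshift_iter.
split=> //.
  apply/funext => i; rewrite iter_shiftE /z /splice !ifF; [|lia..].
  by congr b; lia.
case=> [|k] _; apply: Ndist => // i ltiN.
by rewrite /= /Defs.shift /z /splice ifT.
Qed.
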